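(* Let $X$ be an infinite dimensional, separable $F$-space, let $T \in \mathcal{L}(X)$, and let $\mathcal{F}$ be a family on $\mathbb{N}$. Then there exists some filter $\mathcal{F}' \subset \mathcal{F}$ such that the following conditions are equivalent: (1) $(X,T)$ is $\widetilde{\mathcal{F}}$-transitive. (2) $T$ satisfies the $\mathcal{F}'$-Transitivity Criterion. (3) $(X,T)$ is hereditarily $\mathcal{F}'$-transitive.
   Context: $\mathbb{N}=\{1,2,3,\dots\}$. $\mathcal{L}(X)$ is the set of all bounded (i.e. continuous) linear operators on $X$. ''Opene'' means non-empty and open. For opene $U,V\subset X$, $N(U,V)=\{n\in\mathbb{N}: T^n(U)\cap V\neq\emptyset\}$. A (Furstenberg) family $\mathcal{F}$ on $\mathbb{N}$ is a non-empty collection of infinite subsets of $\mathbb{N}$ that is hereditarily upward: if $A\in\mathcal{F}$ and $A\subset B\subset\mathbb{N}$ then $B\in\mathcal{F}$. A family $\mathcal{F}$ is a filter if $A\cap B\in\mathcal{F}$ for all $A,B\in\mathcal{F}$. For a family $\mathcal{F}$, $$\widetilde{\mathcal{F}}=\{A\subset\mathbb{N}: \forall N\in\mathbb{N}\ \exists B\in\mathcal{F} \text{ such that } (B+[-N,N])\cap\mathbb{N}\subset A\},$$ where $[-N,N]$ denotes the integers between $-N$ and $N$. For a collection $\mathcal{G}$ of subsets of $\mathbb{N}$, $(X,T)$ is $\mathcal{G}$-transitive if $N(U,V)\in\mathcal{G}$ for every pair of opene sets $U,V\subset X$. For a family $\mathcal{F}$, $(X,T)$ is hereditarily $\mathcal{F}$-transitive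 if $N(U,V)\cap A\in\mathcal{F}$ for every pair of opene sets $U,V\subset X$ and every $A\in\mathcal{F}$. For a sequence $(x_n)_{n\in\mathbb{N}}$ in a topological space, $\mathcal{F}$-$\lim_n x_n=x$ means that for every open set $U$ containing $x$, $\{n\in\mathbb{N}:x_n\in U\}\in\mathcal{F}$. $T$ satisfies the $\mathcal{F}$-Transitivity Criterion if there exist two dense subsets $D_1,D_2$ of $X$ and two sequences of mappings (not assumed linear or continuous) $I_n:D_1\to X$, $S_n:D_2\to X$ ($n\in\mathbb{N}$) such that, with limits in $X\times X$: (i) $\mathcal{F}$-$\lim_n (I_n(x),T^n(I_n(x)))=(x,0)$ for every $x\in D_1$; (ii) $\mathcal{F}$-$\lim_n (S_n(y),T^n(S_n(y)))=(0,y)$ for every $y\in D_2$. *)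

(* Defs.v *)
From HB Require Import structures.
From mathcomp Require Import all_boot all_order all_algebra complex.
From mathcomp Require Import all_classical all_reals topology tvs.

Set Implicit Arguments.
Unset Strict Implicit.
Unset Printing Implicit Defensive.

Import Order.TTheory GRing.Theory Num.Theory.

Local Open Scope classical_set_scope.
Local Open Scope ring_scope.

Variant real_or_complex (R : realType) : numFieldType -> Prop :=
| ScalarReal : real_or_complex R R
| ScalarComplex : real_or_complex R (complex R).

Definition is_metric (R : realType) (X : Type) (d : X -> X -> R) : Prop :=
  [/\ forall x y, d x y = 0 <-> x = y,
      forall x y, d x y = d y x &
      forall x y z, d x z <= d x y + d y z].

Definition metric_induces (R : realType) (X : topologicalType)
    (d : X -> X -> R) : Prop :=
  forall (x : X) (U : set X),
    nbhs x U <-> exists2 e : R, 0 < e & [set y | d x y < e] `<=` U.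

Definition metric_complete (R : realType) (X : topologicalType)
    (d : X -> X -> R) : Prop :=
  forall u : nat -> X,
    (forall e : R, 0 < e -> exists M : nat,
       forall m n : nat, (M <= m)%N -> (M <= n)%N -> d (u m) (u n) < e) ->
    exists l : X, u @ \oo --> l.

(* Local convexity is not assumed, so tvsType would be too strong. *)
Definition is_Fspace (R : realType) (K : numFieldType)
    (X : topologicalLmodType K) : Prop :=
  exists d : X -> X -> R,
    [/\ is_metric d, forall x y z : X, d (x + z) (y + z) = d x y,
        metric_induces d & metric_complete d].

Definition infinite_dimensional (K : numFieldType) (X : lmodType K) : Prop :=
  ~ exists (n : nat) (v : 'I_n -> X),
      forall x : X, exists c : 'I_n -> K, x = \sum_(i < n) c i *: v i.

Definition separable (X : topologicalType) : Prop :=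
  exists2 D : set X, countable D & dense D.

(* The positive integers; sets of positive integers are encoded as sets of
   nat that do not contain 0. *)
Definition NN : set nat := [set n | (0 < n)%N].

Definition is_family (F : set (set nat)) : Prop :=
  [/\ F !=set0,
      forall A, F A -> A `<=` NN /\ infinite_set A &
      forall A B, F A -> A `<=` B -> B `<=` NN -> F B].

Definition is_filter (F : set (set nat)) : Prop :=
  is_family F /\ forall A B, F A -> F B -> F (A `&` B).

(* (B + [-N, N]) ∩ NN, the sum being taken in the integers. *)
Definition thicken (B : set nat) (N : nat) : set nat :=
  [set n | NN n /\ exists (b : nat) (k : int),
     [/\ B b, - (N%:Z) <= k <= N%:Z & n%:Z = b%:Z + k]].

Definition tilde (F : set (set nat)) : set (set nat) :=
  [set A | A `<=` NN /\
     forall N : nat, NN N -> exists2 B, F B & thicken B N `<=` A].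

Definition opene (X : topologicalType) (U : set X) : Prop :=
  U !=set0 /\ open U.

Definition return_set (X : Type) (T : X -> X) (U V : set X) : set nat :=
  [set n | NN n /\ (iter n T @` U) `&` V !=set0].

Definition transitive_for (X : topologicalType) (T : X -> X)
    (G : set (set nat)) : Prop :=
  forall U V : set X, opene U -> opene V -> G (return_set T U V).

Definition hereditarily_transitive (X : topologicalType) (T : X -> X)
    (F : set (set nat)) : Prop :=
  forall U V : set X, opene U -> opene V ->
  forall A, F A -> F (return_set T U V `&` A).

(* The term of index 0 of the sequence x plays no role. *)
Definition family_lim (Y : topologicalType) (F : set (set nat))
    (x : nat -> Y) (l : Y) : Prop :=
  forall U : set Y, open U -> U l -> F [set n | NN n /\ U (x n)].

Definition transitivity_criterion (K : numFieldType)
    (X : topologicalLmodType K) (T : X -> X) (F : set (set nat)) : Prop :=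
  exists (D1 D2 : set X) (I : nat -> D1 -> X) (S : nat -> D2 -> X),
    [/\ dense D1, dense D2,
        forall x : D1,
          family_lim F (fun n => (I n x, iter n T (I n x))) (\val x, 0) &
        forall y : D2,
          family_lim F (fun n => (S n y, iter n T (S n y))) (0, \val y)].

(* Main.v *)
Require Import Defs.
From HB Require Import structures.
From mathcomp Require Import all_boot all_order all_algebra complex.
From mathcomp Require Import all_classical all_reals topology tvs.
From mathcomp Require Import zify lra.

Set Implicit Arguments.
Unset Strict Implicit.
Unset Printing Implicit Defensive.

Import Order.TTheory GRing.Theory Num.Theory.

Local Open Scope classical_set_scope.
Local Open Scope ring_scope.

(**
  If T is tilde(F)-transitive, then all return sets N(U,V) are thick, so T is
  weakly mixing and, by Furstenberg's argument, the return sets form a filter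
  base; F' is the filter they generate. It is contained in tilde(F), hence in F.
  If T is not tilde(F)-transitive, F' is the principal filter of a member of F.
  For a filter F', condition (3) just says that every N(U,V) lies in F'; it
  follows from (2) by adding the two approximating sequences, and gives (2)
  because X is first countable and the graphs of the T^n are closed. It gives
  (1) for F' contained in F, since N(U,V) contains B + [-N,N] for B the
  intersection of the N(U, T^-k V) and the N(T^-k U, V) with k <= N.
*)

(** * Return sets and preimages under iterates *)

Lemma return_setP (X : Type) (T : X -> X) (U V : set X) (n : nat) :
  return_set T U V n <-> NN n /\ exists2 x, U x & V (iter n T x).
Proof.
split=> [[n0 [_ [[x Ux <-] Vx]]]|[n0 [x Ux Vx]]]; split=> //; first by exists x.
by exists (iter n T x); split=> //; exists x.
Qed.

Lemma return_set_NN (X : Type) (T : X -> X) (U V : set X) :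
  return_set T U V `<=` NN.
Proof. by move=> n []. Qed.

Lemma continuous_iter (X : topologicalType) (T : X -> X) (n : nat) :
  continuous T -> continuous (iter n T).
Proof.
move=> hT; elim: n => [|n IH] x /=; first exact: cvg_id.
by apply: (@continuous_comp _ _ _ (iter n T) T); [exact: IH | exact: hT].
Qed.

Lemma open_preimage_iter (X : topologicalType) (T : X -> X) (n : nat)
    (V : set X) : continuous T -> open V -> open (iter n T @^-1` V).
Proof.
by move=> hT oV; apply: open_comp => // x _; exact: continuous_iter.
Qed.

Lemma opene_return (X : topologicalType) (T : X -> X) (U V : set X) (n : nat) :
  continuous T -> opene U -> opene V -> return_set T U V n ->
  opene (U `&` iter n T @^-1` V).
Proof.
move=> hT [_ oU] [_ oV] /return_setP[_ [x Ux Vx]]; split; first by exists x.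
by apply: openI => //; exact: open_preimage_iter.
Qed.

Lemma infinite_set_ge (A : set nat) (n : nat) :
  infinite_set A -> exists2 m, A m & (n <= m)%N.
Proof.
move=> Ainf; apply: contrapT => noA; apply: Ainf.
apply: sub_finite_set (finite_II n) => m Am /=.
by rewrite ltnNge; apply/negP => nm; apply: noA; exists m.
Qed.

(* A transitive map has dense range. *)
Lemma opene_preimage_iter (X : topologicalType) (T : X -> X)
    (G : set (set nat)) (V : set X) (n : nat) :
  continuous T -> (forall A, G A -> infinite_set A) -> transitive_for T G ->
  opene V -> opene (iter n T @^-1` V).
Proof.
move=> hT Ginf tT oV; have [[v Vv] oV'] := oV.
split; last exact: open_preimage_iter.
have oX : opene [set: X] by split; [exists v | exact: openT].
have [m] := infinite_set_ge n (Ginf _ (tT _ _ oX oV)).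
move=> /return_setP[_ [x _ Vx]] nm; exists (iter (m - n) T x) => /=.
by rewrite -iterD subnKC.
Qed.

(** * Thick sets, and thickness of return sets that lie in a filter *)

Lemma thickenP (B : set nat) (N n : nat) :
  thicken B N n <->
  NN n /\ exists b, [/\ B b, (n <= b + N)%N & (b <= n + N)%N].
Proof.
split=> [[n0 [b [k [Bb kN nbk]]]]|[n0 [b [Bb nb bn]]]]; split=> //.
  by exists b; split=> //; lia.
by exists b, (n%:Z - b%:Z); split=> //; lia.
Qed.

Lemma tilde_sub (F : set (set nat)) : is_family F -> tilde F `<=` F.
Proof.
move=> [_ FNN Fup] A [ANN /(_ 1%N isT)[B FB BA]].
apply: (Fup B) => // b Bb; apply: BA; apply/thickenP.
by split; [exact: (FNN _ FB).1 | exists b; split=> //; lia].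
Qed.

(** Any large [b] in [B], where [thicken B n] lies inside [A], brings the whole interval
    [b - n, b + n] into [A]. This pair at distance n is how thickness enters Furstenberg's
    argument. *)
Lemma tilde_pair (F : set (set nat)) (A : set nat) (n : nat) :
  is_family F -> tilde F A -> NN n ->
  exists b, [/\ (n < b)%N, A b & A (b - n)%N].
Proof.
move=> [_ FNN _] [_ tA] n0; have [B FB BA] := tA n n0.
have [b Bb nb] := infinite_set_ge n.+1 (FNN _ FB).2.
exists b; split=> //; apply: BA; apply/thickenP; split.
- by rewrite /NN /=; lia.
- by exists b; split=> //; lia.
- by rewrite /NN /=; lia.
- by exists b; split=> //; lia.
Qed.

Lemma filter_finite_inter (G : set (set nat)) (A : nat -> set nat) (N : nat) :
  is_filter G -> (forall k, (k <= N)%N -> G (A k)) ->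
  G [set n | forall k, (k <= N)%N -> A k n].
Proof.
move=> [[_ GNN Gup] GI] GA; elim: N GA => [|N IH] GA.
  have GA0 := GA 0%N (leqnn _); apply: (Gup (A 0%N)) => //.
    by move=> n An [|k].
  by move=> n /(_ 0%N isT); apply: (GNN _ GA0).1.
have GN := GA N.+1 (leqnn _).
apply: Gup (GI _ _ (IH (fun k kN => GA k (leqW kN))) GN) _ _.
  by move=> n [An ANn] k; rewrite leq_eqVlt => /predU1P[->|/An].
by move=> n /(_ N.+1 (leqnn _)); apply: (GNN _ GN).1.
Qed.

Lemma transitive_filter_tilde (X : topologicalType) (T : X -> X)
    (F G : set (set nat)) :
  continuous T -> is_filter G -> G `<=` F -> transitive_for T G ->
  transitive_for T (tilde F).
Proof.
move=> hT GF GsF tT U V oU oV; split; first exact: return_set_NN.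
have [[_ GNN _] GI] := GF.
have Ginf A : G A -> infinite_set A by move=> /GNN[].
move=> N _.
pose A k := return_set T U (iter k T @^-1` V) `&`
            return_set T (iter k T @^-1` U) V.
exists [set n | forall k, (k <= N)%N -> A k n].
  apply: GsF; apply: filter_finite_inter => // k _.
  by apply: GI; apply: (tT) => //; exact: (opene_preimage_iter _ hT Ginf tT).
move=> m /thickenP[m0 [n [An mn nm]]]; apply/return_setP; split=> //.
(* If m >= n, land in T^-(m-n) V at time n and continue for m - n steps. If m < n, take x in
   T^-(n-m) U with T^n x in V and start at T^(n-m) x instead of x. *)
have [le_nm|lt_mn] := leqP n m.
  have [|/return_setP[_ [x Ux Vx]] _] := An (m - n)%N; first by lia.
  by exists x => //; rewrite -(subnK le_nm) iterD.
have [|_ /return_setP[_ [x Ux Vx]]] := An (n - m)%N; first by lia.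
by exists (iter (n - m) T x) => //; rewrite -iterD subnKC // ltnW.
Qed.

Lemma hereditarily_transitiveP (X : topologicalType) (T : X -> X)
    (G : set (set nat)) :
  is_filter G -> hereditarily_transitive T G <-> transitive_for T G.
Proof.
move=> [[[A GA] GNN Gup] GI]; split=> [hT|tT] U V oU oV.
  by apply: Gup (hT _ _ oU oV _ GA) _ _; [move=> n [] | exact: return_set_NN].
by move=> B GB; apply: GI => //; exact: tT.
Qed.

(** * Furstenberg's intersection argument and the filter of return sets *)

Lemma return_set_meet (X : topologicalType) (T : X -> X)
    (F : set (set nat)) (U1 V1 U2 V2 : set X) :
  continuous T -> is_family F -> transitive_for T (tilde F) ->
  opene U1 -> opene V1 -> opene U2 -> opene V2 ->
  return_set T U1 V1 `&` return_set T U2 V2 !=set0.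
Proof.
move=> hT FF tT; have FF' := FF; case: FF' => _ FNN _.
have Finf A : tilde F A -> infinite_set A by move=> /(tilde_sub FF)/FNN[].
have tne U V : opene U -> opene V -> exists n, return_set T U V n.
  move=> oU oV.
  by have [n ?] := infinite_set_ge 0 (Finf _ (tT _ _ oU oV)); exists n.
have meet3 U V V' : opene U -> opene V -> opene V' ->
    return_set T U V `&` return_set T U V' !=set0.
  move=> oU oV oV'; have [n nVV'] := tne _ _ oV oV'.
  (* With W = V ∩ T^-n V', b and b - n in N(U,W) put b in N(U,V) ∩ N(U,V'). *)
  have oW := opene_return hT oV oV' nVV'.
  have [b [nb Wb Wbn]] := tilde_pair FF (tT _ _ oU oW) (return_set_NN nVV').
  exists b; split; apply/return_setP; split; try exact: (return_set_NN Wb).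
    by move: Wb => /return_setP[_ [x Ux []]]; exists x.
  move: Wbn => /return_setP[_ [x Ux [_ /= V'x]]]; exists x => //.
  by rewrite -(subnKC (ltnW nb)) iterD.
(* Two source sets reduce to one: if x lies in U1 ∩ T^-n U2 and T^k x in T^-n V2, then T^n x is a
   point of U2 whose k-th image lies in V2, since T^k and T^n commute. *)
move=> oU1 oV1 oU2 oV2; have [n nU] := tne _ _ oU1 oU2.
have [k [k1 k2]] := meet3 _ _ _ (opene_return hT oU1 oU2 nU) oV1
  (opene_preimage_iter n hT Finf tT oV2).
exists k; split; apply/return_setP; split; try exact: (return_set_NN k1).
  by move: k1 => /return_setP[_ [x [Ux _] Vx]]; exists x.
move: k2 => /return_setP[_ [x [_ Ux] Vx]]; exists (iter n T x) => //.
by rewrite -iterD addnC iterD.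
Qed.

(** Supersets of a single return set are taken, rather than of finite intersections;
    [return_filter_filter] shows that under tilde(F)-transitivity this is already closed under
    intersection. *)
Definition return_filter (X : topologicalType) (T : X -> X) : set (set nat) :=
  [set A | A `<=` NN /\ exists U V : set X,
     [/\ opene U, opene V & return_set T U V `<=` A]].

Lemma transitive_return_filter (X : topologicalType) (T : X -> X) :
  transitive_for T (return_filter T).
Proof. by move=> U V oU oV; split; [exact: return_set_NN | by exists U, V; split]. Qed.

Lemma return_filter_sub (X : topologicalType) (T : X -> X)
    (F : set (set nat)) :
  is_family F -> transitive_for T (tilde F) -> return_filter T `<=` F.
Proof.
move=> FF tT A [ANN [U [V [oU oV UVA]]]].
have [_ _ Fup] := FF.
by apply: Fup UVA ANN; apply: (tilde_sub FF); exact: tT.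
Qed.

Lemma return_filter_filter (X : topologicalType) (T : X -> X)
    (F : set (set nat)) :
  [set: X] !=set0 -> continuous T -> is_family F ->
  transitive_for T (tilde F) -> is_filter (return_filter T).
Proof.
move=> X0 hT FF tT; split.
  split.
  - have oX : opene [set: X] by split=> //; exact: openT.
    by exists (return_set T setT setT); exact: transitive_return_filter.
  - move=> A GA; split; first by case: GA.
    by have [_ FNN _] := FF; apply: (FNN _ (return_filter_sub FF tT GA)).2.
  - move=> A B [_ [U [V [oU oV UVA]]]] AB BNN; split=> //.
    by exists U, V; split=> // n /UVA/AB.
move=> A B [ANN [U1 [V1 [oU1 oV1 A1]]]] [_ [U2 [V2 [oU2 oV2 B2]]]].
split; first by move=> n [/ANN].
(* The sets are paired crosswise: n is a common element of N(U1,U2) and N(V1,V2), so that U1 ∩ T^-n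
   U2 and V1 ∩ T^-n V2 are opene. The return set of these two lies in both N(U1,V1) and N(U2,V2). *)
have [n [nU nV]] := return_set_meet hT FF tT oU1 oU2 oV1 oV2.
exists (U1 `&` iter n T @^-1` U2), (V1 `&` iter n T @^-1` V2).
split; [exact: opene_return | exact: opene_return |].
move=> k /return_setP[k0 [x [U1x U2x] [V1x V2x]]]; split.
  by apply: A1; apply/return_setP; split=> //; exists x.
apply: B2; apply/return_setP; split=> //; exists (iter n T x) => //.
by rewrite -iterD addnC iterD.
Qed.

Lemma exists_filter_sub (F : set (set nat)) :
  is_family F -> exists2 G, is_filter G & G `<=` F.
Proof.
move=> [[A FA] FNN Fup].
exists [set B | A `<=` B /\ B `<=` NN]; last by move=> B [AB BNN]; exact: (Fup A).
split; last first.
  move=> B C [AB BNN] [AC _]; split=> [n An|n [Bn _]]; last exact: BNN.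
  by split; [exact: AB | exact: AC].
split.
- by exists A; split=> //; exact: (FNN _ FA).1.
- by move=> B [AB BNN]; exact: FNN (Fup _ _ FA AB BNN).
- by move=> B C [AB BNN] BC CNN; split=> // n /AB/BC.
Qed.

(** * From the criterion to transitivity *)

Lemma family_lim_nbhs (Y : topologicalType) (G : set (set nat))
    (x : nat -> Y) (l : Y) (U : set Y) :
  is_family G -> family_lim G x l -> nbhs l U -> G [set n | NN n /\ U (x n)].
Proof.
move=> [_ _ Gup] xl lU; apply: Gup (xl _ (@open_interior _ U) lU) _ _.
  by move=> n [n0 /interior_subset].
by move=> n [].
Qed.

Lemma criterion_transitive (K : numFieldType) (X : topologicalLmodType K)
    (T : {linear X -> X}) (G : set (set nat)) :
  is_filter G -> transitivity_criterion T G -> transitive_for T G.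
Proof.
move=> [GF GI] [D1 [D2 [I [S [dD1 dD2 cI cS]]]]] U V [U0 oU] [V0 oV].
have [_ _ Gup] := GF.
have [x [Ux D1x]] := dD1 U U0 oU; have [y [Vy D2y]] := dD2 V V0 oV.
have box (a b : X) (W : set X) : open W -> W (a + b) ->
    exists A B : set X, [/\ nbhs a A, nbhs b B &
      forall a' b', A a' -> B b' -> W (a' + b')].
  move=> oW Wab; have /= := @add_continuous X (a, b) W.
  move=> /(_ (open_nbhs_nbhs (conj oW Wab))) [[A B] /= [nA nB] AB].
  by exists A, B; split=> // a' b' Aa Bb; exact: (AB (a', b')).
(* Writing x = x + 0 and y = 0 + y prepares the witness I_n x + S_n y: it falls in U, and by
   additivity of T^n its image falls in V. *)
have [|A1 [A2 [A1x A20 AU]]] := box x 0 U oU; first by rewrite addr0.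
have [|B1 [B2 [B10 B2y BV]]] := box 0 y V oV; first by rewrite add0r.
have h1 : G [set n | NN n /\ (A1 `*` B1) (I n (SigSub (mem_set D1x)),
    iter n T (I n (SigSub (mem_set D1x))))].
  by apply: (family_lim_nbhs GF (cI _)); exists (A1, B1).
have h2 : G [set n | NN n /\ (A2 `*` B2) (S n (SigSub (mem_set D2y)),
    iter n T (S n (SigSub (mem_set D2y))))].
  by apply: (family_lim_nbhs GF (cS _)); exists (A2, B2).
apply: Gup (GI _ _ h1 h2) _ (@return_set_NN _ _ _ _).
move=> n [[n0 [/= a1 b1]] [_ [/= a2 b2]]]; apply/return_setP; split=> //.
eexists; first exact: AU a1 a2.
suff iterTD u v : iter n T (u + v) = iter n T u + iter n T v.
  by rewrite iterTD; exact: BV.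
by elim: (n) => //= k ->; rewrite linearD.
Qed.

(** * From transitivity to the criterion, through countable neighbourhood bases *)

Lemma Fspace_topology (R : realType) (K : numFieldType)
    (X : topologicalLmodType K) :
  is_Fspace R X -> hausdorff_space X /\
  forall a : X, exists B : nat -> set X,
    [/\ forall m, nbhs a (B m), forall k l, (k <= l)%N -> B l `<=` B k &
        forall U, nbhs a U -> exists m, B m `<=` U].
Proof.
move=> [d [[d0 dC dtri] _ dnbhs _]].
have dge0 x y : 0 <= d x y.
  by have := dtri x y x; rewrite (d0 x x).2 // (dC y x); lra.
split=> [a b clab|a].
  apply/(d0 a b); apply: contrapT => /eqP dab.
  have dab0 : 0 < d a b / 2 by rewrite divr_gt0 // lt_neqAle eq_sym dab dge0.
  have nb x : nbhs x [set y | d x y < d a b / 2].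
    by apply/dnbhs; exists (d a b / 2).
  have [z [/= az bz]] := clab _ _ (nb a) (nb b).
  by have := dtri a z b; rewrite (dC z b); lra.
exists (fun m => [set y | d a y < m.+1%:R^-1]); split=> [m|k l kl y /=|U].
- by apply/dnbhs; exists m.+1%:R^-1 => //; rewrite invr_gt0.
- by move=> /lt_le_trans; apply; rewrite lef_pV2 ?posrE // ler_nat.
move=> /dnbhs[e e0 eU]; have [m me] := ltr_add_invr e0.
exists m => y /= yd; apply: eU => /=; move: me; rewrite add0r.
exact: lt_trans.
Qed.

(** The inhabited levels form a proper initial segment of nat, and a point of the last one belongs
    to all of them. The default [x0] serves when no level is inhabited. *)
Lemma exists_deepest (X : Type) (x0 : X) (Q : nat -> X -> Prop) :
  (forall k l z, (k <= l)%N -> Q l z -> Q k z) -> ~ (forall m, exists z, Q m z) ->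
  exists z, forall m, (exists z', Q m z') -> Q m z.
Proof.
move=> Qle /existsNP; have [P PE] : exists P : nat -> bool,
    forall m, P m <-> ~ exists z, Q m z.
  by exists (fun m => `[< ~ exists z, Q m z >]) => m; split=> /asboolP.
move=> exQ; have exP : exists m, P m by case: exQ => m /PE; exists m.
have [k /PE nQk kmin] := ex_minnP exP.
case: k nQk kmin => [|k] nQk kmin.
  by exists x0 => m [z' Qz']; case: nQk; exists z'; exact: Qle Qz'.
have [z Qz] : exists z, Q k z.
  by apply: contrapT => /PE/kmin; rewrite ltnn.
exists z => m [z' Qz']; apply: (Qle m k) => //; rewrite leqNgt.
by apply/negP => km; apply: nQk; exists z'; exact: Qle Qz'.
Qed.

(** One sequence must serve all neighbourhoods of (a, b). So (z n, T^n (z n)) is placed in every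
    basic box [A m] x [B m] that the graph of T^n meets. Box m is met at each n in the return set of
    the interiors of [A m] and [B m], which belongs to G. *)
Lemma transitive_approx (X : topologicalType) (T : X -> X)
    (G : set (set nat)) (a b : X) :
  hausdorff_space X ->
  (forall x : X, exists B : nat -> set X,
    [/\ forall m, nbhs x (B m), forall k l, (k <= l)%N -> B l `<=` B k &
        forall U, nbhs x U -> exists m, B m `<=` U]) ->
  continuous T -> is_family G -> transitive_for T G ->
  exists z : nat -> X, family_lim G (fun n => (z n, iter n T (z n))) (a, b).
Proof.
move=> hX basis hT [_ GNN Gup] tT.
have [A [nA Aanti Abase]] := basis a; have [B [nB Banti Bbase]] := basis b.
pose Q n m z := A m z /\ B m (iter n T z).
have /choice[z zP] n :
    exists z, forall m, (exists z', Q n m z') -> Q n m z.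
  have [Qall|nQ] := pselect (forall m, exists z, Q n m z).
    (* Here T^n a = b, because the graph of T^n is closed. *)
    suff Tab : iter n T a = b.
      by exists a => m _; rewrite /Q Tab; split; exact: nbhs_singleton.
    apply: hX => P P' nP nP'.
    have [i iP] := Abase _ (continuous_iter hT nP).
    have [j jP'] := Bbase _ nP'.
    have [z [Az Bz]] := Qall (maxn i j); exists (iter n T z); split.
      by apply: iP; apply: Aanti Az; exact: leq_maxl.
    by apply: jP'; apply: Banti Bz; exact: leq_maxr.
  apply: (exists_deepest a _ nQ) => k l z kl [Az Bz].
  by split; [exact: Aanti Az | exact: Banti Bz].
exists z => W oW Wab.
have [[P P'] /= [nP nP'] PW] := open_nbhs_nbhs (conj oW Wab).
have [i iP] := Abase _ nP; have [j jP'] := Bbase _ nP'.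
have op (x : X) C : nbhs x C -> opene C^°.
  by move=> nC; split; [exists x | exact: open_interior].
pose m := maxn i j.
apply: Gup (tT _ _ (op _ _ (nA m)) (op _ _ (nB m))) _ _; last by move=> n [].
move=> n /return_setP[n0 [y Ay By]]; split=> //; apply: PW.
have [|Az Bz] := zP n m; first by exists y; split; exact: interior_subset.
split; first by apply: iP; apply: Aanti Az; exact: leq_maxl.
by apply: jP'; apply: Banti Bz; exact: leq_maxr.
Qed.

Lemma transitive_criterion (R : realType) (K : numFieldType)
    (X : topologicalLmodType K) (T : {linear X -> X}) (G : set (set nat)) :
  is_Fspace R X -> continuous T -> is_family G -> transitive_for T G ->
  transitivity_criterion T G.
Proof.
move=> /Fspace_topology[hX basis] hT GF tT.
have approx a b := transitive_approx a b hX basis hT GF tT.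
have /choice[I hI] := fun a => approx a 0.
have /choice[S hS] := fun b => approx 0 b.
have dT : dense [set: X] by move=> U [x Ux] _; exists x.
by exists setT, setT, (fun n x => I (\val x) n), (fun n y => S (\val y) n); split.
Qed.

Theorem theorem3p4 (R : realType) (K : numFieldType)
    (hK : real_or_complex R K)
    (X : topologicalLmodType K)
    (hX : is_Fspace R X)
    (hsep : separable X)
    (hdim : infinite_dimensional X)
    (T : {linear X -> X}) (hT : continuous T)
    (F : set (set nat)) (hF : is_family F) :
  exists F' : set (set nat),
    [/\ is_filter F', F' `<=` F,
        transitive_for T (tilde F) <-> transitivity_criterion T F' &
        transitivity_criterion T F' <-> hereditarily_transitive T F'].
Proof.
have [G [GF GsF tG]] : exists G, [/\ is_filter G, G `<=` F &
    transitive_for T (tilde F) -> transitive_for T G].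
  have [tT|ntT] := pselect (transitive_for T (tilde F)).
    exists (return_filter T); split; last by move=> _; exact: transitive_return_filter.
      by apply: (return_filter_filter _ hT hF tT); exists 0.
    exact: return_filter_sub.
  (* Here the last implication is vacuous, so any filter inside F will do: all three conditions
     fail, since transitivity for such a filter would give tilde(F)-transitivity. *)
  by have [G GF GsF] := exists_filter_sub hF; exists G.
have critP : transitivity_criterion T G <-> transitive_for T G.
  split; first exact: criterion_transitive.
  by apply: transitive_criterion hX hT _; case: GF.
exists G; split=> //; last by rewrite critP hereditarily_transitiveP.
rewrite critP; split=> //; exact: transitive_filter_tilde.
Qed.
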